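(* There exist positive universal constants $c, c_1, c_2, c_3$ such that the following holds. For any positive $\mu_1,\mu_2,\lambda,D,\epsilon$ with $\frac{\mu_1}{\lambda}\geq c_1$, $\frac{\mu_2}{\lambda}D\geq c_2$ and $\epsilon<\frac{c_3\lambda^3}{\mu_2^2}$, and for any deterministic second-order algorithm with initialization point $\mathbf{w}_1$, there exists a function $f:\mathbb{R}^d\to\mathbb{R}$ (for some finite $d$) such that: (i) $f$ is $\lambda$-strongly convex, twice-differentiable, has $\mu_1$-Lipschitz gradients and $\mu_2$-Lipschitz Hessians, and has a global minimum $\mathbf{w}^*$ satisfying $\|\mathbf{w}_1-\mathbf{w}^*\|\leq D$; (ii) any index $T$ for which the point $\mathbf{w}_T$ produced by the algorithm on $f$ satisfies $f(\mathbf{w}_T)-f(\mathbf{w}^* )\leq\epsilon$ must satisfy $$T\;\geq\; c\cdot\left(\min\left\{\sqrt{\frac{\mu_1}{\lambda}}~,~\left(\frac{\mu_2}{\lambda}D\right)^{2/7}\right\}+\log\log_{18}\left(\frac{\lambda^3/\mu_2^2}{\epsilon}\right)\right).$$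
   Context: A second-order oracle for $f$, given a point $\mathbf{w}$, returns $f(\mathbf{w})$, $\nabla f(\mathbf{w})$ and $\nabla^2 f(\mathbf{w})$. A deterministic second-order algorithm produces a sequence of points $\mathbf{w}_1,\mathbf{w}_2,\ldots$ in $\mathbb{R}^d$, where each $\mathbf{w}_t$ is a deterministic function of the oracle's responses at $\mathbf{w}_1,\ldots,\mathbf{w}_{t-1}$ (so $\mathbf{w}_1$ is fixed before any oracle call). The dimension $d$ is not fixed in advance and may depend on the other problem parameters; an algorithm is understood to be specified for every dimension $d$. Norms are Euclidean for vectors and spectral for matrices; ''$L$-Lipschitz gradients (Hessians)'' means $\nabla f$ (resp. $\nabla^2 f$) is $L$-Lipschitz with respect to these norms. A twice-differentiable $f$ is $\lambda$-strongly convex if $\nabla^2 f(\mathbf{w})\succeq\lambda I$ for all $\mathbf{w}$. The outer logarithm $\log$ is to a fixed base, whose choice only affects the universal constants. *)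

(* Defs.v *)
From mathcomp Require Import all_boot all_order all_algebra.
From mathcomp Require Import all_classical all_reals all_analysis.

Set Implicit Arguments.
Unset Strict Implicit.
Unset Printing Implicit Defensive.

Import Order.TTheory GRing.Theory Num.Theory.
Import numFieldNormedType.Exports.

Local Open Scope classical_set_scope.
Local Open Scope ring_scope.

(* Points of R^d are row vectors. The norm that the library attaches to
   'rV[R]_d and 'M[R]_d is the sup norm; it is used below only through
   differentiability, which does not depend on the choice of norm. *)

Definition enorm (R : realType) (d : nat) (v : 'rV[R]_d) : R :=
  Num.sqrt (\sum_(i < d) v 0 i ^+ 2).

(* v *m A^T is the row vector of A applied to v. The set is nonempty and
   bounded above, so sup is the true supremum. *)
Definition spectral_norm (R : realType) (d : nat) (A : 'M[R]_d) : R :=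
  sup [set enorm (v *m A^T) | v in [set v : 'rV[R]_d | enorm v <= 1]].

Definition gradient (R : realType) (d : nat) (f : 'rV[R]_d -> R)
    (w : 'rV[R]_d) : 'rV[R]_d :=
  \row_(i < d) 'D_(delta_mx 0 i) f w.

(* 'J g w is characterised by v *m 'J g w = 'd g w v, so entry (i, j) is the
   i-th partial derivative of the j-th partial derivative of f. *)
Definition hessian (R : realType) (d : nat) (f : 'rV[R]_d -> R)
    (w : 'rV[R]_d) : 'M[R]_d :=
  'J (gradient f) w.

Definition twice_differentiable (R : realType) (d : nat)
    (f : 'rV[R]_d -> R) : Prop :=
  forall w : 'rV[R]_d, differentiable f w /\ differentiable (gradient f) w.

Definition psd (R : realType) (d : nat) (A : 'M[R]_d) : Prop :=
  A^T = A /\ forall v : 'rV[R]_d, 0 <= (v *m A *m v^T) 0 0.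

Definition strongly_convex (R : realType) (d : nat) (lambda : R)
    (f : 'rV[R]_d -> R) : Prop :=
  forall w : 'rV[R]_d, psd (hessian f w - lambda%:M).

Definition lipschitz_gradient (R : realType) (d : nat) (L : R)
    (f : 'rV[R]_d -> R) : Prop :=
  forall u v : 'rV[R]_d,
    enorm (gradient f u - gradient f v) <= L * enorm (u - v).

Definition lipschitz_hessian (R : realType) (d : nat) (L : R)
    (f : 'rV[R]_d -> R) : Prop :=
  forall u v : 'rV[R]_d,
    spectral_norm (hessian f u - hessian f v) <= L * enorm (u - v).

Definition response (R : realType) (d : nat) : Type :=
  (R * 'rV[R]_d * 'M[R]_d)%type.

Definition oracle (R : realType) (d : nat) (f : 'rV[R]_d -> R)
    (w : 'rV[R]_d) : response R d :=
  (f w, gradient f w, hessian f w).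

(* In each dimension, the next query point as a function of the responses
   received so far, oldest first; A d [::] is the initialization point. The
   query points need not be recorded: they are determined by the responses. *)
Definition algorithm (R : realType) : Type :=
  forall d : nat, seq (response R d) -> 'rV[R]_d.

Fixpoint transcript (R : realType) (A : algorithm R) (d : nat)
    (f : 'rV[R]_d -> R) (n : nat) : seq (response R d) :=
  if n is m.+1 then
    let h := transcript A f m in rcons h (oracle f (A d h))
  else [::].

(* Indexing starts at 1: the t-th point depends on t - 1 responses. The value
   at t = 0 is meaningless. *)
Definition iterate (R : realType) (A : algorithm R) (d : nat)
    (f : 'rV[R]_d -> R) (t : nat) : 'rV[R]_d :=
  A d (transcript A f t.-1).

Definition log_base (R : realType) (b x : R) : R := ln x / ln b.

(* Main.v *)
From HB Require Import structures.
Require Import Defs.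
From mathcomp Require Import all_boot all_order all_algebra.
From mathcomp Require Import all_classical all_reals all_analysis.
From mathcomp Require Import ring lra.

Import Order.TTheory GRing.Theory Num.Theory.
Import numFieldNormedType.Exports.

Local Open Scope ring_scope.

(** The hard function is, up to translation to the initialization point c and
in orthonormal coordinates x_k = <V_k, w - c> (with V_k = 0 for k >= n),

  sum over k < n of g_k (x_k - x_{k+1})  -  lambda s_0 x_0  +  lambda/2 |x|^2,

where each spring g_k is convex and g_k, g_k', g_k'' vanish at 0.

Why it is slow to minimize.  At a point orthogonal to V_t, V_{t+1}, ... only
the springs k < t are stretched, so the oracle reveals nothing about the
directions after V_t ([oracle_hard_fun]).  An adversary can therefore choose
V_t after seeing the first t+1 queries, orthogonally to all of them; 2n
dimensions leave enough room for n such choices ([resisting_basis]).  Query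
number t (from 0) then has a zero coordinate along V_t, whereas the minimizer
has coordinate a_t there, and by strong convexity the query has suboptimality at
least lambda/2 a_t^2.  If these lower bounds all exceed eps for t < n, then more
than n queries are necessary ([hard_instance]).

Why the minimizer can be prescribed.  Write a_k = s_k - s_{k+1}, so that s is
the sequence of tail sums of a.  Stationarity says that the force of the
k-th spring at its rest elongation a_k - a_{k+1} is lambda s_{k+1}.  Springs
are rescalings of a single rational profile, growing like a quartic near 0 and
like a quadratic far away, whose elbow is put exactly at the rest elongation;
the force condition then fixes the stiffness.  So any strictly decreasing a is
allowed, as long as the resulting springs respect the two smoothness bounds:
this is [admissible], which asks lambda s_{k+1} to be at most a constant times
mu1 (a_k - a_{k+1}) and at most a constant times mu2 (a_k - a_{k+1})^2.

Why the two terms of the bound appear.  In units of lambda/mu2 the second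
constraint is a discrete form of s <= s''^2.  Cubic a, hence quartic s, solve
it, with mu1/lambda at least of order n^2 and |a| of order n^(7/2); this gives
the minimum of the square root and of the power 2/7.  A sequence s which is
squared at each step solves it too, and stays above the level set by eps for
log log (1/eps) steps.  The larger of the two terms decides which of the two
sequences is used; since the larger term is at least half the sum, this loses
only a constant factor. *)

(** * The spring profile *)

Section Profile.
Context {R : realType}.
Implicit Types x y z : R.

Definition recip y : R := (1 + y ^+ 2)^-1.

(** This is y^4 / (1 + y^2): a rational function keeps both derivatives, and
all the bounds on them, within elementary algebra. *)
Definition profile y : R := y ^+ 2 - 1 + recip y.
Definition profile' y : R := 2 * y - 2 * y * recip y ^+ 2.
Definition profile'' y : R := 2 + 6 * recip y ^+ 2 - 8 * recip y ^+ 3.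

Lemma onesq_gt0 y : 0 < 1 + y ^+ 2.
Proof. by rewrite ltr_wpDr ?sqr_ge0. Qed.

Lemma onesq_neq0 y : 1 + y ^+ 2 != 0.
Proof. by rewrite lt0r_neq0 ?onesq_gt0. Qed.

Lemma recip_gt0 y : 0 < recip y.
Proof. by rewrite invr_gt0 onesq_gt0. Qed.

Lemma recip_le1 y : recip y <= 1.
Proof. by rewrite invf_le1 ?onesq_gt0 // lerDl sqr_ge0. Qed.

Lemma recip_mul y : recip y * (1 + y ^+ 2) = 1.
Proof. by rewrite mulVf ?onesq_neq0. Qed.

Lemma mul_recip_le y : `|y * recip y| <= 2^-1.
Proof.
have u0 := recip_gt0 y; rewrite normrM (gtr0_norm u0) /recip ler_pdivrMr ?onesq_gt0//.
have := sqr_ge0 (`|y| - 1); rewrite sqrrB1 real_normK ?num_real //; lra.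
Qed.

(** The factors z * recip z and y * recip y on the right are bounded, which is
where the Lipschitz bounds on the derivatives of the profile come from. *)
Lemma recipB y z : recip y - recip z = (z - y) * (z + y) * recip y * recip z.
Proof. by rewrite /recip; field; rewrite !onesq_neq0. Qed.

Lemma is_derive_recip y : is_derive y 1 recip (- 2 * y * recip y ^+ 2).
Proof.
have d : is_derive y (1 : R) (fun z : R => 1 + z ^+ 2) (2 * y).
  by apply: is_derive_eq; rewrite add0r /= scaler1 /GRing.scale /=; ring.
have := @is_deriveV _ (fun z : R => 1 + z ^+ 2) y _ 1 (onesq_neq0 y) d.
rewrite /GRing.scale /= -/recip => h.
by apply: is_derive_eq; rewrite -exprVn -/(recip y); ring.
Qed.

Lemma is_derive_profile y : is_derive y 1 profile (profile' y).
Proof.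
have d := is_derive_recip y.
by apply: is_derive_eq; rewrite /profile' subr0 /= !scaler1 /GRing.scale /=; ring.
Qed.

Lemma is_derive_profile' y : is_derive y 1 profile' (profile'' y).
Proof.
have d := is_derive_recip y.
have E : y ^+ 2 * recip y = 1 - recip y by rewrite -(recip_mul y); ring.
apply: is_derive_eq; rewrite /GRing.scale /=.
transitivity (2 - 2 * recip y ^+ 2 + 8 * (y ^+ 2 * recip y) * recip y ^+ 2).
  ring.
by rewrite E /profile''; ring.
Qed.

Lemma profile0 : profile 0 = 0.
Proof. by rewrite /profile /recip expr0n /= addr0 invr1; ring. Qed.

Lemma profile'0 : profile' 0 = 0.
Proof. by rewrite /profile' !mulr0 mul0r subr0. Qed.

Lemma profile''0 : profile'' 0 = 0.
Proof. by rewrite /profile'' /recip expr0n /= addr0 invr1; ring. Qed.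

Lemma profile'1 : profile' 1 = 3 / 2.
Proof. by rewrite /profile' /recip expr1n; field. Qed.

Lemma profile''_ge0 y : 0 <= profile'' y.
Proof.
have := recip_gt0 y; have := recip_le1 y; rewrite /profile''.
move: (recip y) => u u1 u0; nra.
Qed.

(** The Bregman divergence is (y - z)^2 times a quotient of sums of squares. *)
Lemma profile_convex y z : 0 <= profile y - profile z - profile' z * (y - z).
Proof.
have -> : profile y - profile z - profile' z * (y - z) =
  (y - z) ^+ 2 * ((y + z) ^+ 2 + 2 * y ^+ 2 * z ^+ 2 + 2 * z ^+ 2 + z ^+ 4
     + y ^+ 2 * z ^+ 4) * recip y * recip z ^+ 2.
  by rewrite /profile /profile' /recip; field; rewrite !onesq_neq0.
do 3?apply: mulr_ge0; rewrite ?sqr_ge0 ?(ltW (recip_gt0 _)) //.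
have z4 : 0 <= z ^+ 4 by rewrite exprn_even_ge0.
have y2 := sqr_ge0 y; have z2 := sqr_ge0 z.
by rewrite !addr_ge0 ?sqr_ge0 // ?(mulr_ge0 y2) // ?(mulr_ge0 (ler0n _ 2)) // -mulrA
  (mulr_ge0 (ler0n _ 2)) ?(mulr_ge0 y2).
Qed.

(** With p = y u, q = z v, u = recip y and v = recip z, the difference is
(y - z) times a polynomial in the bounded quantities p, q, u, v. *)
Lemma profile'_lip y z : `|profile' y - profile' z| <= 6 * `|y - z|.
Proof.
set u := recip y; set v := recip z; pose p := y * u; pose q := z * v.
have -> : profile' y - profile' z =
    (2 - 2 * ((u * v - p * q) * u - q * (p * v + q * u))) * (y - z).
  have Epq : p - q = (y - z) * (u * v - p * q).
    by rewrite /p /q /u /v /recip; field; rewrite !onesq_neq0.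
  have -> : profile' y - profile' z =
      2 * (y - z) - 2 * ((p - q) * u + q * (u - v)).
    by rewrite /profile' -/u -/v /p /q; ring.
  by rewrite Epq recipB -/u -/v /p /q; ring.
rewrite normrM ler_wpM2r //.
have := recip_gt0 y; have := recip_le1 y; have := recip_gt0 z; have := recip_le1 z.
have := mul_recip_le y; have := mul_recip_le z.
rewrite -/u -/v -/p -/q !ler_norml => /andP[q1 q2] /andP[p1 p2] v1 v0 u1 u0.
clearbody u v p q; have ? : -1/4 <= p*q <= 1/4 by nra.
have ? : 0 <= u * v <= 1 by nra.
have ? : 0 <= q * q <= 1/4 by nra.
have ? : -(5/4) <= (u * v - p * q) * u <= 5/4 by nra.
have ? : -1/4 <= q * p * v <= 1/4 by nra.
have ? : 0 <= q * q * u <= 1/4 by nra.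
apply/andP; lra.
Qed.

Lemma profile''_lip y z : `|profile'' y - profile'' z| <= 12 * `|y - z|.
Proof.
set u := recip y; set v := recip z; pose p := y * u; pose q := z * v.
have -> : profile'' y - profile'' z =
   - (6 * (u + v) - 8 * (u ^+ 2 + u * v + v ^+ 2)) * (q * u + p * v) * (y - z).
  have -> : profile'' y - profile'' z =
     (6 * (u + v) - 8 * (u ^+ 2 + u * v + v ^+ 2)) * (u - v).
    by rewrite /profile'' -/u -/v; ring.
  by rewrite recipB -/u -/v /p /q; ring.
rewrite normrM ler_wpM2r // normrM -[leRHS]mulr1.
have := recip_gt0 y; have := recip_le1 y; have := recip_gt0 z; have := recip_le1 z.
have := mul_recip_le y; have := mul_recip_le z.
rewrite -/u -/v -/p -/q !ler_norml => /andP[q1 q2] /andP[p1 p2] v1 v0 u1 u0.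
clearbody u v p q.
apply: ler_pM => //; rewrite ler_norml; apply/andP; split; nra.
Qed.
End Profile.

(** * Euclidean geometry of row vectors *)

Section Euclidean.
Context {R : realType} {d : nat}.
Implicit Types (u v w x y z : 'rV[R]_d) (c : R).

Definition dot u v : R := (u *m v^T) 0 0.

Lemma dotE u v : dot u v = \sum_i u 0 i * v 0 i.
Proof. by rewrite /dot mxE; apply: eq_bigr => i _; rewrite mxE. Qed.

Lemma dotC u v : dot u v = dot v u.
Proof. by rewrite !dotE; apply: eq_bigr => i _; rewrite mulrC. Qed.

Fact dot_is_linear u : linear (dot u).
Proof. by move=> c v w; rewrite /dot linearP mulmxDr -scalemxAr !mxE. Qed.

HB.instance Definition _ u := GRing.isLinear.Build R 'rV[R]_d R *%R (dot u)
  (dot_is_linear u).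

Lemma dot0l v : dot 0 v = 0.
Proof. by rewrite dotC linear0. Qed.

Lemma dotDl u v w : dot (u + v) w = dot u w + dot v w.
Proof. by rewrite dotC linearD /= !(dotC w). Qed.

Lemma dotBl u v w : dot (u - v) w = dot u w - dot v w.
Proof. by rewrite dotC linearB /= !(dotC w). Qed.

Lemma dotZl c u v : dot (c *: u) v = c * dot u v.
Proof. by rewrite dotC linearZ /= dotC. Qed.

Lemma dot_suml n (F : 'I_n -> 'rV[R]_d) v :
  dot (\sum_i F i) v = \sum_i dot (F i) v.
Proof. by rewrite dotC linear_sum /=; apply: eq_bigr => i _; rewrite dotC. Qed.

Lemma dot_ge0 v : 0 <= dot v v.
Proof. by rewrite dotE sumr_ge0 // => i _; rewrite -expr2 sqr_ge0. Qed.

Lemma dot_eq0 v : (dot v v == 0) = (v == 0).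
Proof.
apply/eqP/eqP => [|->]; last exact: dot0l.
move=> /eqP; rewrite dotE psumr_eq0 => [/allP v0|i _]; last first.
  by rewrite -expr2 sqr_ge0.
apply/rowP => i; have := v0 i; rewrite mem_index_enum -expr2 sqrf_eq0 mxE => h.
by apply/eqP/h.
Qed.

Lemma enormE v : enorm v = Num.sqrt (dot v v).
Proof. by rewrite /enorm dotE; under eq_bigr do rewrite expr2. Qed.

Lemma enorm_ge0 v : 0 <= enorm v.
Proof. by rewrite enormE sqrtr_ge0. Qed.

Lemma sqr_enorm v : enorm v ^+ 2 = dot v v.
Proof. by rewrite enormE sqr_sqrtr ?dot_ge0. Qed.

Lemma enorm_le v c : 0 <= c -> dot v v <= c ^+ 2 -> enorm v <= c.
Proof.
by move=> c0; rewrite -sqr_enorm ler_pXn2r ?nnegrE ?enorm_ge0.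
Qed.

Lemma spectral_norm_le (A : 'M[R]_d) c :
  (forall v, enorm v <= 1 -> enorm (v *m A^T) <= c) -> spectral_norm A <= c.
Proof.
move=> h; apply: ge_sup; last by move=> _ [v /= /h ? <-].
exists (enorm (0 *m A^T)), 0 => //=.
by rewrite enormE dot0l sqrtr0.
Qed.

Lemma mulmx_rank1 v u : v *m (u^T *m u) = dot u v *: u.
Proof.
rewrite mulmxA [v *m u^T]mx11_scalar mul_scalar_mx; congr (_ *: _).
by rewrite dotC.
Qed.

(** Fewer than d vectors are the columns of a matrix of rank less than d, whose
left kernel is not trivial. *)
Lemma exists_unit_orthogonal (s : seq 'rV[R]_d) : (size s < d)%N ->
  exists v, dot v v = 1 /\ forall u, u \in s -> dot v u = 0.
Proof.
move=> sd; pose M := \matrix_(i < d, j < size s) (s`_j) 0 i.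
have : kermx M != 0.
  rewrite -mxrank_eq0 mxrank_ker -lt0n subn_gt0.
  by apply: leq_ltn_trans sd; exact: rank_leq_col.
move=> /rowV0Pn[v /sub_kermxP vM v0].
have vv : 0 < dot v v by rewrite lt_neqAle dot_ge0 andbT eq_sym dot_eq0.
exists ((enorm v)^-1 *: v); split=> [|u /(nthP 0) [j js <-]].
  by rewrite dotZl linearZ /= mulrA -expr2 exprVn sqr_enorm mulVf ?gt_eqF.
rewrite dotZl; have /rowP/(_ (Ordinal js)) := vM; rewrite !mxE => e.
apply/eqP; rewrite mulf_eq0; apply/orP; right; rewrite -e dotE; apply/eqP.
by apply: eq_bigr => i _; rewrite mxE.
Qed.

End Euclidean.

(** * Chains of orthonormal vectors *)

Section Chain.
Context {R : realType} {d : nat}.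
Implicit Types (V : nat -> 'rV[R]_d) (x y z : 'rV[R]_d) (c : nat -> R).

(** The zero tail lets the last link of a chain be V (n - 1) itself, and lets a
basis under construction be a member of the same type of objects as the
finished one. *)
Definition orthonormal_upto n V :=
  (forall i j, (i < n)%N -> (j < n)%N -> dot (V i) (V j) = (i == j)%:R) /\
  (forall j, (n <= j)%N -> V j = 0).

Definition link V k := V k - V k.+1.

Context {n : nat} {V : nat -> 'rV[R]_d} (oV : orthonormal_upto n V).

Lemma dot_combination c j : (forall i, (n <= i)%N -> c i = 0) ->
  dot (V j) (\sum_(i < n) c i *: V i) = c j.
Proof.
move=> c0; rewrite linear_sum /=; case: (ltnP j n) => jn; last first.
  by rewrite c0 // big1 // => i _; rewrite oV.2 // dot0l.
rewrite (bigD1 (Ordinal jn)) //= big1 ?addr0 => [|i ij].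
  by rewrite linearZ /= oV.1 // eqxx mulr1.
rewrite linearZ /= oV.1 // (_ : (j == i) = false) ?mulr0 //.
by apply/negbTE; move: ij; apply: contraNneq => e; apply/eqP/val_inj.
Qed.

(** Expand the square of the distance from x to its projection. *)
Lemma bessel x : \sum_(i < n) dot (V i) x ^+ 2 <= dot x x.
Proof.
pose p i := dot (V i) x.
pose y := \sum_(i < n) p i *: V i.
have pn i : (n <= i)%N -> p i = 0 by move=> ni; rewrite /p oV.2 // dot0l.
have xy : dot y x = \sum_(i < n) p i ^+ 2.
  by rewrite dot_suml; apply: eq_bigr => i _; rewrite dotZl expr2.
have yy : dot y y = \sum_(i < n) p i ^+ 2.
  rewrite {1}/y dot_suml; apply: eq_bigr => i _.
  by rewrite dotZl dot_combination // expr2.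
have := dot_ge0 (x - y); rewrite dotBl !linearB /= (dotC x) xy yy -/p; lra.
Qed.

(** Each coordinate of x occurs in two links, and (p - q)^2 <= 2 p^2 + 2 q^2. *)
Lemma sum_dot_link x : \sum_(k < n) dot (link V k) x ^+ 2 <= 4 * dot x x.
Proof.
have le : \sum_(k < n) dot (link V k) x ^+ 2 <=
    \sum_(k < n) (2 * dot (V k) x ^+ 2 + 2 * dot (V k.+1) x ^+ 2).
  apply: ler_sum => k _; rewrite /link dotBl.
  have := sqr_ge0 (dot (V k) x + dot (V k.+1) x); nra.
apply: (le_trans le); rewrite big_split /= -!mulr_sumr.
have : \sum_(k < n) dot (V k.+1) x ^+ 2 <= \sum_(k < n) dot (V k) x ^+ 2.
  have := big_ord_recl n (fun i => dot (V i) x ^+ 2) (idx := 0) (op := +%R).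
  rewrite big_ord_recr /= oV.2 // dot0l expr0n addr0 => ->.
  by rewrite lerDr sqr_ge0.
have := bessel x; lra.
Qed.

Lemma dot_link_le x k : (k < n)%N -> dot (link V k) x ^+ 2 <= 4 * dot x x.
Proof.
move=> kn; apply: le_trans (sum_dot_link x).
rewrite (bigD1 (Ordinal kn)) //= lerDl sumr_ge0 // => i _; exact: sqr_ge0.
Qed.

(** Dual to [sum_dot_link]: pair the sum T with itself, then bound each
c k * <link k, T> by 2 (c k)^2 + <link k, T>^2 / 8, whose second part sums to at
most half of the square of T. *)
Lemma sqnorm_sum_link c :
  dot (\sum_(k < n) c k *: link V k) (\sum_(k < n) c k *: link V k)
    <= 4 * \sum_(k < n) c k ^+ 2.
Proof.
set T := \sum_(k < n) _.
have e : dot T T = \sum_(k < n) c k * dot (link V k) T.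
  by rewrite {1}/T dot_suml; apply: eq_bigr => k _; rewrite dotZl.
have le : dot T T <= \sum_(k < n) (2 * c k ^+ 2 + dot (link V k) T ^+ 2 / 8).
  rewrite e; apply: ler_sum => k _.
  have := sqr_ge0 (c k - dot (link V k) T / 4); nra.
move: le; rewrite big_split /= -mulr_sumr -mulr_suml.
have := sum_dot_link T; lra.
Qed.

(** The operator sum_k h_k link_k^T link_k has spectral norm at most 4 max |h_k|;
the form with a bound on c covers both the differences of gradients, where the
spring forces are nonlinear, and the differences of Hessians. *)
Lemma sqnorm_sum_link_le c H x : 0 <= H ->
  (forall k, (k < n)%N -> `|c k| <= H * `|dot (link V k) x|) ->
  dot (\sum_(k < n) c k *: link V k) (\sum_(k < n) c k *: link V k)
    <= (4 * H) ^+ 2 * dot x x.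
Proof.
move=> H0 cH; apply: (le_trans (sqnorm_sum_link c)).
have : \sum_(k < n) c k ^+ 2 <= \sum_(k < n) H ^+ 2 * dot (link V k) x ^+ 2.
  apply: ler_sum => k _; rewrite -exprMn -(@real_normK _ (c k)) ?num_real //.
  rewrite -[leRHS]real_normK ?num_real // ler_pXn2r ?nnegrE //.
  by rewrite normrM (ger0_norm H0) cH.
rewrite -mulr_sumr => le.
have := ler_wpM2l (sqr_ge0 H) (sum_dot_link x); move: le; rewrite exprMn; lra.
Qed.

End Chain.

(** * Calculus of sums of ridge functions *)

Section RidgeSum.
Context {R : realType} {d : nat}.
Implicit Types (u v w x c : 'rV[R]_d).

Lemma is_diff_dot u x : is_diff x (dot u) (dot u).
Proof.
have df y : differentiable (dot u) y.
  rewrite (_ : dot u = \sum_(i < d) (u 0 i *: (fun v => v 0 i))); last first.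
    apply/funext => v; rewrite dotE fct_sumE.
    by apply: eq_bigr.
  apply: differentiable_sum => i; apply: differentiableZ.
  exact: differentiable_coord.
apply: DiffDef => //; apply: (@diff_lin R 'rV[R]_d R (dot u)) => y.
exact: differentiable_continuous.
Qed.

Lemma is_diff_dot_shift u c x : is_diff x (fun w => dot u (w - c)) (dot u).
Proof.
rewrite (_ : (fun w => _) = dot u - cst (dot u c)); last first.
  by apply/funext => w; rewrite linearB.
have ? := is_diff_dot u x.
by apply: is_diff_eq; apply/funext => v; rewrite !fctE /= subr0.
Qed.

Lemma is_diff_ridge {g : R -> R} {dg} u c x :
  is_derive (dot u (x - c)) 1 g dg ->
  is_diff x (fun w => g (dot u (w - c))) (fun v => dg * dot u v).
Proof.
move=> gd.
have h := is_diff_dot_shift u c x.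
have h2 : is_diff (dot u (x - c)) g (fun t => t * dg).
  apply: DiffDef; first by apply/derivable1_diffP; exact: ex_derive.
  rewrite diff1E; last by apply/derivable1_diffP; exact: ex_derive.
  by apply/funext => t; rewrite derive1E derive_val.
apply: (@is_diff_eq _ _ _ _ _ _ _ (is_diff_comp h h2)).
by apply/funext => v /=; rewrite mulrC.
Qed.

Lemma is_diff_sum {W : normedModType R} {n} {f df : 'I_n -> 'rV[R]_d -> W} {x} :
  (forall i, is_diff x (f i) (df i)) ->
  is_diff x (\sum_(i < n) f i) (\sum_(i < n) df i).
Proof.
by move=> h; elim/big_ind2: _ => // [|? ? ? ? ? ?]; [exact: is_diff_cst|exact: is_diffD].
Qed.

Variables (n : nat) (g g' g'' : nat -> R -> R) (u : nat -> 'rV[R]_d).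
Variables (b c : 'rV[R]_d) (lam : R).
Hypothesis g'P : forall k (t : R), is_derive t (1 : R) (g k) (g' k t).
Hypothesis g''P : forall k (t : R), is_derive t (1 : R) (g' k) (g'' k t).

Definition ridge_sum w : R := \sum_(k < n) g k (dot (u k) (w - c)) +
  (dot b (w - c) + lam / 2 * dot (w - c) (w - c)).

Definition ridge_grad w : 'rV[R]_d :=
  \sum_(k < n) g' k (dot (u k) (w - c)) *: u k + (b + lam *: (w - c)).

Definition ridge_hess w : 'M[R]_d :=
  \sum_(k < n) g'' k (dot (u k) (w - c)) *: ((u k)^T *m u k) + lam%:M.

Lemma dot_delta (i : 'I_d) x : dot (delta_mx 0 i) x = x 0 i.
Proof. by rewrite /dot -rowE !mxE. Qed.

(** The square of the norm is the sum of the ridge functions t^2 along the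
coordinate axes. *)
Lemma is_diff_sqnorm x :
  is_diff x (fun w => dot (w - c) (w - c)) (fun v => 2 * dot (x - c) v).
Proof.
rewrite (_ : (fun w => _) =
  \sum_(i < d) (fun w => dot (delta_mx 0 i) (w - c) ^+ 2)); last first.
  apply/funext => w; rewrite fct_sumE dotE; apply: eq_bigr => i _.
  by rewrite dot_delta expr2.
have sq t : is_derive t (1 : R) (fun t => t ^+ 2) (2 * t).
  by apply: is_derive_eq; rewrite /GRing.scale /=; ring.
have h i : is_diff x (fun w => dot (delta_mx 0 i) (w - c) ^+ 2)
    (fun v => 2 * dot (delta_mx 0 i) (x - c) * dot (delta_mx 0 i) v).
  exact: is_diff_ridge (sq _).
apply: is_diff_eq; first exact: is_diff_sum h.
apply/funext => v; rewrite fct_sumE dotE mulr_sumr; apply: eq_bigr => i _.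
by rewrite !dot_delta mulrA.
Qed.

Lemma is_diff_ridge_sum x : is_diff x ridge_sum (dot (ridge_grad x)).
Proof.
have h1 := is_diff_sum (fun k : 'I_n => is_diff_ridge (u k) c x (g'P k _)).
have h2 := is_diff_dot_shift b c x.
have h3 := is_diffZ (lam / 2) (is_diff_sqnorm x).
rewrite (_ : ridge_sum = \sum_(k < n) (fun w => g k (dot (u k) (w - c))) +
  ((fun w => dot b (w - c)) + (lam / 2) *: (fun w => dot (w - c) (w - c)))); last first.
  by apply/funext => w; rewrite !fctE fct_sumE.
apply: (is_diff_eq (is_diffD h1 (is_diffD h2 h3))); apply/funext => v.
rewrite !fctE fct_sumE /ridge_grad [RHS]dotDl (dotDl b) (dotZl lam) dot_suml /=.
congr (_ + _).
  by apply: eq_bigr => k _; rewrite dotZl.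
by rewrite /GRing.scale /=; field.
Qed.

Lemma gradient_ridge_sum : gradient ridge_sum = ridge_grad.
Proof.
apply/funext => x; apply/rowP => i; rewrite mxE.
have h := is_diff_ridge_sum x.
by rewrite deriveE; [rewrite diff_val dotC dot_delta|exact: ex_diff].
Qed.

Lemma is_diff_ridge_grad x :
  is_diff x ridge_grad (fun v => v *m ridge_hess x).
Proof.
have h1 : is_diff x (\sum_(k < n) (fun w => g' k (dot (u k) (w - c)) *: u k))
   (\sum_(k < n) (fun v => (g'' k (dot (u k) (x - c)) * dot (u k) v) *: u k)).
  apply: is_diff_sum => k; have hk := is_diff_ridge (u k) c x (g''P k _).
  exact: is_diff_comp hk (is_diff_scalel _ (u k)).
rewrite (_ : ridge_grad = \sum_(k < n) (fun w => g' k (dot (u k) (w - c)) *: u k) +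
  (cst b + lam *: (id - cst c))); last first.
  by apply/funext => w; rewrite !fctE fct_sumE.
have h2 := is_diffZ lam (is_diffB (is_diff_id x) (is_diff_cst c x)).
apply: (is_diff_eq (is_diffD h1 (is_diffD (is_diff_cst b x) h2))).
apply/funext => v.
rewrite !fctE fct_sumE mulmxDr mul_mx_scalar /= add0r subr0; congr (_ + _).
rewrite mulmx_sumr; apply: eq_bigr => k _.
by rewrite -scalemxAr mulmx_rank1 scalerA dotC.
Qed.

Lemma hessian_ridge_sum : hessian ridge_sum = ridge_hess.
Proof.
apply/funext => x; rewrite /hessian gradient_ridge_sum /jacobian.
have h := is_diff_ridge_grad x.
apply/row_matrixP => i; rewrite !rowE mul_rV_lin1.
by rewrite diff_val.
Qed.

Lemma twice_differentiable_ridge_sum : twice_differentiable ridge_sum.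
Proof.
move=> w; rewrite gradient_ridge_sum; split.
  have h := is_diff_ridge_sum w; exact: ex_diff.
have h := is_diff_ridge_grad w; exact: ex_diff.
Qed.

Lemma strongly_convex_ridge_sum : (forall k t, (k < n)%N -> 0 <= g'' k t) ->
  strongly_convex lam ridge_sum.
Proof.
move=> g0 w; rewrite hessian_ridge_sum /ridge_hess addrK; split.
  rewrite linear_sum; apply: eq_bigr => k _.
  by rewrite linearZ /= trmx_mul trmxK.
move=> v; rewrite mulmx_sumr mulmx_suml summxE sumr_ge0 // => k _.
rewrite -scalemxAr mulmx_rank1 -!scalemxAl mxE mulr_ge0 ?g0 //.
by rewrite mxE -/(dot _ _) dotC -expr2 sqr_ge0.
Qed.

(** Add the convexity inequalities of the g k at their values at the critical
point: the first-order terms cancel and the quadratic term remains. *)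
Lemma ridge_sum_min xs : ridge_grad (c + xs) = 0 -> 
  (forall k s t, (k < n)%N -> 0 <= g k s - g k t - g' k t * (s - t)) ->
  forall w, lam / 2 * dot (w - c - xs) (w - c - xs) <=
    ridge_sum w - ridge_sum (c + xs).
Proof.
move=> cr cv w; set x := w - c.
have cxs : c + xs - c = xs by rewrite addrC addKr.
move: cr; rewrite /ridge_grad cxs => cr.
rewrite /ridge_sum cxs -/x; clearbody x.
have : \sum_(k < n) dot (g' k (dot (u k) xs) *: u k) (x - xs) +
    (dot b (x - xs) + lam * dot xs (x - xs)) = 0.
  by rewrite -dotZl -dotDl -dot_suml -dotDl cr dot0l.
have : 0 <= \sum_(k < n) (g k (dot (u k) x) - g k (dot (u k) xs) -
     g' k (dot (u k) xs) * (dot (u k) x - dot (u k) xs)).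
  by apply: sumr_ge0 => k _; exact: cv.
rewrite !big_split /= !sumrN.
have -> : \sum_(k < n) g' k (dot (u k) xs) * (dot (u k) x - dot (u k) xs) =
   \sum_(k < n) dot (g' k (dot (u k) xs) *: u k) (x - xs).
  by apply: eq_bigr => k _; rewrite dotZl linearB.
rewrite !linearB /= !dotBl (dotC xs x); lra.
Qed.

End RidgeSum.

(** * Smoothness of chain potentials *)

Section ChainPotential.
Context {R : realType} {d : nat}.
Implicit Types (x y w c b : 'rV[R]_d).
Context {n : nat} {V : nat -> 'rV[R]_d} (oV : orthonormal_upto n V).
Variables (g g' g'' : nat -> R -> R) (b c : 'rV[R]_d) (lam : R).
Hypothesis g'P : forall k (t : R), is_derive t (1 : R) (g k) (g' k t).
Hypothesis g''P : forall k (t : R), is_derive t (1 : R) (g' k) (g'' k t).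

Let F := ridge_sum n g (link V) b c lam.

Lemma dotD_le x y : dot (x + y) (x + y) <= 2 * dot x x + 2 * dot y y.
Proof.
have := dot_ge0 (x - y).
rewrite dotBl !linearB /= dotDl !linearD /= (dotC y x); lra.
Qed.

Lemma lipschitz_gradient_chain L : 0 <= lam -> 2 * lam <= L ->
  (forall k s t, (k < n)%N -> `|g' k s - g' k t| <= L / 8 * `|s - t|) ->
  lipschitz_gradient L F.
Proof.
move=> lam0 lamL gL x y.
rewrite (gradient_ridge_sum _ _ _ _ _ _ _ g'P).
pose q k := g' k (dot (link V k) (x - c)) - g' k (dot (link V k) (y - c)).
have -> : ridge_grad n g' (link V) b c lam x - ridge_grad n g' (link V) b c lam y =
    \sum_(k < n) q k *: link V k + lam *: (x - y).
  rewrite /ridge_grad opprD addrACA -sumrB; congr (_ + _).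
    by apply: eq_bigr => k _; rewrite -scalerBl.
  by rewrite opprD addrACA subrr add0r -scalerBr opprB addrA subrK.
have L0 : 0 <= L by lra.
apply: enorm_le; first by rewrite mulr_ge0 ?enorm_ge0.
rewrite exprMn sqr_enorm; apply: (le_trans (dotD_le _ _)).
have le : dot (\sum_(k < n) q k *: link V k) (\sum_(k < n) q k *: link V k) <=
    (4 * (L / 8)) ^+ 2 * dot (x - y) (x - y).
  apply: (sqnorm_sum_link_le oV); first by rewrite divr_ge0.
  move=> k kn; apply: (le_trans (gL _ _ _ kn)).
  by rewrite -linearB /= opprB addrA subrK.
rewrite dotZl linearZ /= mulrA.
have := dot_ge0 (x - y); move: le; set z := dot (x - y) (x - y) => le z0.
have : lam ^+ 2 * z <= (L / 2) ^+ 2 * z.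
  rewrite ler_wpM2r // ler_pXn2r ?nnegrE ?divr_ge0 //; lra.
move: le; rewrite (_ : 4 * (L / 8) = L / 2); last by field.
lra.
Qed.

Lemma lipschitz_hessian_chain L : 0 <= L ->
  (forall k s t, (k < n)%N -> `|g'' k s - g'' k t| <= L / 8 * `|s - t|) ->
  lipschitz_hessian L F.
Proof.
move=> L0 gL x y.
rewrite (hessian_ridge_sum _ _ _ _ _ _ _ _ g'P g''P).
pose q k := g'' k (dot (link V k) (x - c)) - g'' k (dot (link V k) (y - c)).
have -> : ridge_hess n g'' (link V) c lam x - ridge_hess n g'' (link V) c lam y =
    \sum_(k < n) q k *: ((link V k)^T *m link V k).
  rewrite /ridge_hess opprD addrACA subrr addr0 -sumrB.
  by apply: eq_bigr => k _; rewrite -scalerBl.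
have e0 := enorm_ge0 (x - y).
apply: spectral_norm_le => v v1.
have -> : v *m (\sum_(k < n) q k *: ((link V k)^T *m link V k))^T =
    \sum_(k < n) (q k * dot (link V k) v) *: link V k.
  rewrite linear_sum mulmx_sumr; apply: eq_bigr => k _ /=.
  by rewrite linearZ /= trmx_mul trmxK -scalemxAr mulmx_rank1 scalerA dotC.
apply: enorm_le; first by rewrite mulr_ge0.
have le : dot (\sum_(k < n) (q k * dot (link V k) v) *: link V k)
    (\sum_(k < n) (q k * dot (link V k) v) *: link V k) <=
    (4 * (L / 4 * enorm (x - y))) ^+ 2 * dot v v.
  apply: (sqnorm_sum_link_le oV (fun k => q k * dot (link V k) v)).
    by rewrite mulr_ge0 ?divr_ge0.
  move=> k kn.
  rewrite normrM ler_wpM2r //.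
  apply: (le_trans (gL _ _ _ kn)).
  have -> : L / 4 * enorm (x - y) = L / 8 * (2 * enorm (x - y)) by field.
  rewrite ler_wpM2l ?divr_ge0 //.
  rewrite -linearB /= opprB addrA subrK.
  rewrite -(@ler_pXn2r _ 2) ?nnegrE ?mulr_ge0 //.
  rewrite real_normK ?num_real // exprMn sqr_enorm.
  by apply: le_trans (dot_link_le oV (x - y) _ kn) _; rewrite expr2; lra.
apply: (le_trans le); rewrite mulrA (_ : 4 * (L / 4) = L); last by field.
rewrite ler_piMr ?sqr_ge0 // -sqr_enorm -(expr1n _ 2).
by rewrite ler_pXn2r ?nnegrE ?enorm_ge0.
Qed.

End ChainPotential.

(** * Springs *)

Section Springs.
Context {R : realType}.
Implicit Types (kap del t : R).

(** kap is the Lipschitz scale of the second derivative, and del is the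
elongation around which the spring changes from quartic to quadratic: the second
derivative is bounded by a multiple of kap * del. *)
Definition spring kap del t := kap * del ^+ 3 * profile (t / del).
Definition spring' kap del t := kap * del ^+ 2 * profile' (t / del).
Definition spring'' kap del t := kap * del * profile'' (t / del).

Lemma is_derive_rescale (p p' : R -> R) (del t : R) :
  (forall y : R, is_derive y (1 : R) p (p' y)) ->
  is_derive t (1 : R) (fun s => p (s / del)) (p' (t / del) / del).
Proof.
move=> pP.
have h : is_derive t (1 : R) (fun s => s / del) del^-1.
  by apply: is_derive_eq; rewrite /GRing.scale /= mulr0 add0r mulr1.
have := @is_derive1_comp _ p (fun s => s / del) _ _ _ (pP (t / del)) h.
by move=> h2; apply: is_derive_eq; rewrite /GRing.scale /= mulrC.
Qed.

(** When del = 0, as happens for the springs beyond the end of a chain, both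
sides vanish. *)
Lemma is_derive_spring kap del t :
  is_derive t (1 : R) (spring kap del) (spring' kap del t).
Proof.
have h := is_derive_rescale _ _ del t is_derive_profile.
apply: is_derive_eq; rewrite /GRing.scale /= /spring'.
have [->|d0] := eqVneq del 0; first by rewrite !expr0n !mulr0 !mul0r.
by field.
Qed.

Lemma is_derive_spring' kap del t :
  is_derive t (1 : R) (spring' kap del) (spring'' kap del t).
Proof.
have h := is_derive_rescale _ _ del t is_derive_profile'.
apply: is_derive_eq; rewrite /GRing.scale /= /spring''.
have [->|d0] := eqVneq del 0; first by rewrite !expr0n !mulr0 !mul0r.
by field.
Qed.

Lemma spring_at0 kap del :
  (spring kap del 0 = 0) * (spring' kap del 0 = 0) * (spring'' kap del 0 = 0).
Proof.
by rewrite /spring /spring' /spring'' mul0r profile0 profile'0 profile''0 !mulr0.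
Qed.

(** The factor 3 / 2, the slope of the profile at its elbow, is the one which
[stiffness] cancels. *)
Lemma spring'_rest kap del : del != 0 -> spring' kap del del = 3 / 2 * kap * del ^+ 2.
Proof. by move=> d0; rewrite /spring' divff // profile'1; ring. Qed.

Lemma spring''_ge0 kap del t : 0 <= kap -> 0 <= del -> 0 <= spring'' kap del t.
Proof. by move=> k0 d0; rewrite !mulr_ge0 ?profile''_ge0. Qed.

Lemma spring_convex kap del s t : 0 <= kap -> 0 < del ->
  0 <= spring kap del s - spring kap del t - spring' kap del t * (s - t).
Proof.
move=> k0 d0; have dn0 := lt0r_neq0 d0.
have -> : spring kap del s - spring kap del t - spring' kap del t * (s - t) =
  kap * del ^+ 3 * (profile (s / del) - profile (t / del)
    - profile' (t / del) * (s / del - t / del)).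
  by rewrite /spring /spring'; field.
by rewrite mulr_ge0 ?profile_convex // mulr_ge0 // exprn_ge0 // ltW.
Qed.

Lemma spring'_lip kap del s t : 0 <= kap -> 0 < del ->
  `|spring' kap del s - spring' kap del t| <= 6 * kap * del * `|s - t|.
Proof.
move=> k0 d0; have dn0 := lt0r_neq0 d0.
have kd0 : 0 <= kap * del ^+ 2 by rewrite mulr_ge0 // sqr_ge0.
rewrite /spring' -mulrBr normrM ger0_norm //.
have := profile'_lip (s / del) (t / del).
rewrite -mulrBl normrM normfV (gtr0_norm d0) => le.
have -> : 6 * kap * del * `|s - t| = kap * del ^+ 2 * (6 * (`|s - t| / del)).
  by field.
by rewrite ler_wpM2l.
Qed.

Lemma spring''_lip kap del s t : 0 <= kap -> 0 < del ->
  `|spring'' kap del s - spring'' kap del t| <= 12 * kap * `|s - t|.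
Proof.
move=> k0 d0; have dn0 := lt0r_neq0 d0.
have kd0 : 0 <= kap * del by rewrite mulr_ge0 // ltW.
rewrite /spring'' -mulrBr normrM ger0_norm //.
have := profile''_lip (s / del) (t / del).
rewrite -mulrBl normrM normfV (gtr0_norm d0) => le.
have -> : 12 * kap * `|s - t| = kap * del * (12 * (`|s - t| / del)) by field.
by rewrite ler_wpM2l.
Qed.

End Springs.

(** * The hard function *)

Section HardFunction.
Context {R : realType} {d : nat}.
Implicit Types (x w c : 'rV[R]_d) (V : nat -> 'rV[R]_d) (s : nat -> R).

(** s lists the tail sums of the coordinates of the minimizer, and the gaps are
the elongations of the springs at the minimizer.  Tail sums rather than the
coordinates are primitive since the spring forces are multiples of them. *)
Definition coord s i := s i - s i.+1.
Definition gap s k := coord s k - coord s k.+1.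
(** Solves spring' kap (gap s k) (gap s k) = lam * s k.+1 for kap. *)
Definition stiffness (lam : R) s k := 2 / 3 * lam * s k.+1 / gap s k ^+ 2.

Definition hard_fun n lam s V c : 'rV[R]_d -> R :=
  ridge_sum n (fun k => spring (stiffness lam s k) (gap s k)) (link V)
    (- (lam * s 0) *: V 0) c lam.

Definition hard_argmin n s V : 'rV[R]_d := \sum_(i < n) coord s i *: V i.

(** The last two conditions bound 8 times the Lipschitz constants of the first
and second derivatives of the springs by mu1 and mu2 (see [spring'_lip],
[spring''_lip] and [stiffness]). *)
Definition admissible (n : nat) (mu1 mu2 lam : R) s : Prop :=
  [/\ forall k, 0 <= s k,
      forall k, (n <= k)%N -> s k = 0,
      forall k, (k < n)%N -> 0 < gap s k,
      forall k, (k < n)%N -> 32 * lam * s k.+1 <= mu1 * gap s k &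
      forall k, (k < n)%N -> 64 * lam * s k.+1 <= mu2 * gap s k ^+ 2].

(** At a point orthogonal to V_t, V_{t+1}, ... the springs from the t-th on are
not stretched, and a spring is flat to second order at 0. *)
Lemma oracle_hard_fun n lam s V V' c t w :
  (forall i, (i <= t)%N -> V i = V' i) ->
  (forall j, (t <= j)%N -> dot (V j) (w - c) = 0) ->
  (forall j, (t <= j)%N -> dot (V' j) (w - c) = 0) ->
  oracle (hard_fun n lam s V c) w = oracle (hard_fun n lam s V' c) w.
Proof.
move=> eqV oV oV'; rewrite /oracle /hard_fun.
rewrite !(gradient_ridge_sum _ _ _ _ _ _ _ (fun k => @is_derive_spring R _ _)).
rewrite !(hessian_ridge_sum _ _ _ _ _ _ _ _ (fun k => @is_derive_spring R _ _)
  (fun k => @is_derive_spring' R _ _)).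
have z U k : (forall j, (t <= j)%N -> dot (U j) (w - c) = 0) -> (t <= k)%N ->
    dot (link U k) (w - c) = 0.
  by move=> oU tk; rewrite dotBl !oU ?subr0 // leqW.
have e k : (k < t)%N -> link V k = link V' k.
  by move=> kt; rewrite /link !eqV // ltnW.
rewrite /ridge_sum /ridge_grad /ridge_hess (eqV 0%N) //.
congr (_, _, _); congr (_ + _); apply: eq_bigr => k _;
  case: (ltnP k t) => kt; rewrite ?(e _ kt) // !z // !spring_at0 ?scale0r //.
Qed.

Section Regularity.
Context {n : nat} {mu1 mu2 lam : R} {s : nat -> R} {V : nat -> 'rV[R]_d}
  {c : 'rV[R]_d}.
Hypotheses (lam0 : 0 < lam) (oV : orthonormal_upto n V)
  (adm : admissible n mu1 mu2 lam s).

Let f := hard_fun n lam s V c.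
Let kap := stiffness lam s.

Lemma stiffness_ge0 k : 0 <= kap k.
Proof.
have [s0 _ _ _ _] := adm.
rewrite /kap /stiffness mulr_ge0 ?invr_ge0 ?sqr_ge0 //.
by rewrite !mulr_ge0 ?invr_ge0 // ltW.
Qed.

Lemma twice_differentiable_hard_fun : twice_differentiable f.
Proof.
exact: (twice_differentiable_ridge_sum _ _ _ _ _ _ _ _
  (fun k => is_derive_spring _ _) (fun k => is_derive_spring' _ _)).
Qed.

Lemma strongly_convex_hard_fun : strongly_convex lam f.
Proof.
have [_ _ g0 _ _] := adm.
apply: (strongly_convex_ridge_sum _ _ _ _ _ _ _ _
  (fun k => is_derive_spring _ _) (fun k => is_derive_spring' _ _)).
by move=> k t kn; rewrite spring''_ge0 ?stiffness_ge0 // ltW ?g0.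
Qed.

Lemma lipschitz_gradient_hard_fun : 2 * lam <= mu1 -> lipschitz_gradient mu1 f.
Proof.
have [_ _ g0 h1 _] := adm.
move=> lam1; apply: (lipschitz_gradient_chain oV _ _ _ _ _
  (fun k => is_derive_spring _ _)) => //; first exact: ltW.
move=> k x y kn; apply: (le_trans (spring'_lip _ _ _ _ (stiffness_ge0 k) (g0 _ kn))).
rewrite ler_wpM2r //; have gk := g0 _ kn.
have -> : 6 * stiffness lam s k * gap s k = 4 * lam * s k.+1 / gap s k.
  by rewrite /stiffness; field; rewrite lt0r_neq0.
rewrite ler_pdivrMr //; have := h1 _ kn; lra.
Qed.

Lemma lipschitz_hessian_hard_fun : 0 <= mu2 -> lipschitz_hessian mu2 f.
Proof.
have [_ _ g0 _ h2] := adm.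
move=> mu20; apply: (lipschitz_hessian_chain oV _ _ _ _ _ _
  (fun k => is_derive_spring _ _) (fun k => is_derive_spring' _ _)) => //.
move=> k x y kn; apply: (le_trans (spring''_lip _ _ _ _ (stiffness_ge0 k) (g0 _ kn))).
rewrite ler_wpM2r //; have gk := g0 _ kn.
have -> : 12 * stiffness lam s k = 8 * lam * s k.+1 / gap s k ^+ 2.
  by rewrite /stiffness; field; rewrite lt0r_neq0.
rewrite ler_pdivrMr ?exprn_gt0 //; have := h2 _ kn; lra.
Qed.

Lemma coord_end i : (n <= i)%N -> coord s i = 0.
Proof.
by have [_ s_end _ _ _] := adm => ni; rewrite /coord !s_end ?subr0 // leqW.
Qed.

(** Abel summation: the spring forces were chosen so that the coefficients of
each V_i telescope. *)
Lemma hard_argmin_critical :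
  ridge_grad n (fun k => spring' (stiffness lam s k) (gap s k)) (link V)
    (- (lam * s 0) *: V 0) c lam (c + hard_argmin n s V) = 0.
Proof.
have [_ s_end g0 _ _] := adm.
rewrite /ridge_grad (addrC c) addrK.
have -> : \sum_(k < n) spring' (stiffness lam s k) (gap s k)
      (dot (link V k) (hard_argmin n s V)) *: link V k =
    lam *: \sum_(k < n) s k.+1 *: (V k - V k.+1).
  rewrite scaler_sumr; apply: eq_bigr => k _.
  rewrite scalerA; congr (_ *: _).
  rewrite dotBl !(dot_combination oV) => [||]; try exact: coord_end.
  have gn0 := lt0r_neq0 (g0 _ (ltn_ord k)).
  by rewrite -/(gap s k) spring'_rest // /stiffness; field.
rewrite scaleNr -scalerA -scalerN -!scalerDr addrCA -big_split /=.
have -> : \sum_(i < n) (s i.+1 *: (V i - V i.+1) + coord s i *: V i) =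
    \sum_(i < n) (s i *: V i - s i.+1 *: V i.+1).
  apply: eq_bigr => i _.
  by rewrite addrC scalerBr scalerBl addrA subrK.
have := big_ord_recl n (fun i => s i *: V i) (idx := 0) (op := +%R).
rewrite big_ord_recr /= s_end // scale0r addr0 sumrB => ->.
by rewrite addrK addNr scaler0.
Qed.

Lemma hard_fun_growth w :
  lam / 2 * dot (w - c - hard_argmin n s V) (w - c - hard_argmin n s V) <=
  f w - f (c + hard_argmin n s V).
Proof.
have [_ _ g0 _ _] := adm.
apply: (ridge_sum_min _ _ _ _ _ _ _ _ hard_argmin_critical) => k x y kn.
by apply: spring_convex; rewrite ?stiffness_ge0 ?g0.
Qed.

Lemma dot_hard_argmin j : dot (V j) (hard_argmin n s V) = coord s j.
Proof. by rewrite (dot_combination oV) //; exact: coord_end. Qed.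

Lemma sqnorm_hard_argmin :
  dot (hard_argmin n s V) (hard_argmin n s V) = \sum_(i < n) coord s i ^+ 2.
Proof.
rewrite {1}/hard_argmin dot_suml; apply: eq_bigr => i _.
by rewrite dotZl dot_hard_argmin expr2.
Qed.

End Regularity.
End HardFunction.

(** * The resisting oracle *)

Section Resisting.
Context {R : realType}.

(** Induction on the number of vectors chosen.  Replacing the zero at position m
by a unit vector v orthogonal to the previous vectors and to the first m + 1
queries does not change the first m answers, by [oracle_hard_fun], and hence not
those queries either.  The query at time 0 is c itself and needs no constraint,
so v avoids 2 m vectors. *)
Lemma resisting_basis (A : algorithm R) (d n : nat) (lam : R) (s : nat -> R) :
  (n.*2 <= d)%N ->
  let c := A d [::] in
  exists V : nat -> 'rV[R]_d, orthonormal_upto n V /\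
    forall t j, (t <= j)%N ->
      dot (V j) (A d (transcript A (hard_fun n lam s V c) t) - c) = 0.
Proof.
move=> nd c; pose x V t := A d (transcript A (hard_fun n lam s V c) t) - c.
suff: forall m, (m <= n)%N -> exists V : nat -> 'rV[R]_d, orthonormal_upto m V /\
    forall t j, (t <= j)%N -> dot (V j) (x V t) = 0 by move/(_ n (leqnn n)).
elim=> [|m IH] mn.
  exists (fun=> 0); split; last by move=> *; rewrite dot0l.
  by split.
have [V [oV Vx]] := IH (ltnW mn).
pose old := [seq x V t | t <- iota 1 m] ++ [seq V i | i <- iota 0 m].
have [|v [vv vold]] := exists_unit_orthogonal old.
  rewrite size_cat !size_map !size_iota addnn.
  by apply: leq_trans nd; rewrite ltn_double.
have vx t : (t <= m)%N -> dot v (x V t) = 0.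
  case: t => [|t] tm; first by rewrite /x /= subrr linear0.
  by apply: vold; rewrite mem_cat map_f // mem_iota.
have vV i : (i < m)%N -> dot v (V i) = 0.
  by move=> im; apply: vold; rewrite mem_cat map_f ?orbT // mem_iota.
pose V' i := if i == m then v else V i.
have V'm : V' m = v by rewrite /V' eqxx.
have V'lt i : (i < m)%N -> V' i = V i by rewrite /V'; case: ltngtP.
have V'gt i : (m < i)%N -> V' i = 0.
  by move=> mi; rewrite /V' gtn_eqF // oV.2 // ltnW.
(* The first m answers do not depend on the choice of v. *)
have xV t : (t <= m)%N -> transcript A (hard_fun n lam s V c) t =
    transcript A (hard_fun n lam s V' c) t.
  elim: t => [//|t IHt] tm /=.
  rewrite -IHt; last exact: ltnW.
  rewrite (oracle_hard_fun n lam s V V' c t) //.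
  - by move=> i it; rewrite V'lt //; exact: leq_ltn_trans tm.
  - by move=> j tj; exact: Vx.
  - move=> j tj; case: (ltngtP j m) => jm.
    + by rewrite V'lt //; exact: Vx.
    + by rewrite V'gt // dot0l.
    + by rewrite jm V'm; apply: vx; exact: ltnW.
have xE t : (t <= m)%N -> x V' t = x V t by move=> tm; rewrite /x xV.
exists V'; split; last first.
  move=> t j tj; case: (ltngtP j m) => jm.
  - rewrite V'lt // xE; last exact: leq_trans tj (ltnW jm).
    exact: Vx.
  - by rewrite V'gt // dot0l.
  - by rewrite jm V'm xE -?jm // vx // -jm.
split=> [i j|j /V'gt//]; rewrite !ltnS.
case: ltngtP => // im _; case: (ltngtP j m) => // jm _.
- by rewrite !V'lt // oV.1.
- by rewrite jm V'm V'lt // dotC vV // ltn_eqF.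
- by rewrite im V'm V'lt // vV // gtn_eqF.
- by rewrite im jm V'm vv eqxx.
Qed.

(** A query made too early has a zero coordinate where the minimizer does not;
[bessel] and [hard_fun_growth] make this a lower bound on the suboptimality. *)
Lemma hard_instance (A : algorithm R) (n : nat) (mu1 mu2 lam D eps : R)
    (s : nat -> R) :
  (0 < n)%N -> 0 < lam -> 2 * lam <= mu1 -> 0 <= mu2 -> 0 <= D ->
  admissible n mu1 mu2 lam s ->
  \sum_(i < n) coord s i ^+ 2 <= D ^+ 2 ->
  (forall i, (i < n)%N -> eps < lam / 2 * coord s i ^+ 2) ->
  exists (d : nat) (f : 'rV[R]_d -> R) (wstar : 'rV[R]_d),
    [/\ (0 < d)%N,
        [/\ twice_differentiable f, strongly_convex lam f,
            lipschitz_gradient mu1 f & lipschitz_hessian mu2 f],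
        (forall w : 'rV[R]_d, f wstar <= f w),
        enorm (iterate A f 1 - wstar) <= D &
        forall T : nat, (1 <= T)%N ->
          f (iterate A f T) - f wstar <= eps -> (n < T)%N].
Proof.
move=> n0 lam0 lam1 mu20 D0 adm nD ne; exists n.*2.
have [V [oV Vx]] := resisting_basis A n.*2 n lam s (leqnn _).
set c := A _ _ in Vx; set f := hard_fun n lam s V c in Vx.
have growth := hard_fun_growth lam0 oV adm (c := c).
exists f, (c + hard_argmin n s V); split.
- by rewrite double_gt0.
- split; [exact: twice_differentiable_hard_fun|exact: (strongly_convex_hard_fun lam0 adm)
   |exact: (lipschitz_gradient_hard_fun lam0 oV adm)
   |exact: (lipschitz_hessian_hard_fun lam0 oV adm)].
- move=> w; rewrite -subr_ge0; apply: le_trans (growth w).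
  by rewrite mulr_ge0 ?dot_ge0 // divr_ge0 // ltW.
- rewrite /iterate /= -/c opprD addrA subrr add0r; apply: enorm_le => //.
  by rewrite -scaleN1r dotZl linearZ /= (sqnorm_hard_argmin oV adm); lra.
- case=> // t _ le; rewrite ltnS leqNgt; apply/negP => tn.
  have := le_trans (growth _) le; set y := _ - c.
  have yt : dot (V t) y = 0 by exact: Vx.
  have := bessel oV (y - hard_argmin n s V).
  rewrite (bigD1 (Ordinal tn)) //= linearB /= yt (dot_hard_argmin oV adm) sub0r sqrrN.
  have := ne _ tn.
  have : 0 <= \sum_(i < n | i != Ordinal tn) dot (V i) (y - hard_argmin n s V) ^+ 2.
    by rewrite sumr_ge0 // => i _; exact: sqr_ge0.
  nra.
Qed.

End Resisting.

(** * Minimizers with polynomially decreasing coordinates *)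

Section Polynomial.
Context {R : realType}.

(** Tail sums of the cubes 2 r (p - i)^3; the truncated subtraction makes them
vanish from p on. *)
Definition poly_tail (p : nat) (r : R) i : R :=
  r / 2 * ((p - i)%:R * ((p - i)%:R + 1)) ^+ 2.

Lemma coord_poly_tail p r i : coord (poly_tail p r) i = 2 * r * (p - i)%:R ^+ 3.
Proof.
rewrite /coord /poly_tail; case: (ltnP i p) => ip; last first.
  have [-> ->] : (p - i = 0 /\ p - i.+1 = 0)%N.
    by split; apply/eqP; rewrite subn_eq0 // leqW.
  by rewrite expr0n !mul0r expr0n !mulr0 subr0.
by rewrite -(subnSK ip) -natr1; field.
Qed.

Lemma gap_poly_tail p r i : (i < p)%N -> gap (poly_tail p r) i =
  2 * r * (3 * ((p - i)%:R * (p - i.+1)%:R) + 1).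
Proof. by move=> ip; rewrite /gap !coord_poly_tail -(subnSK ip) -natr1; ring. Qed.

Lemma poly_tailS p r i : (i < p)%N ->
  poly_tail p r i.+1 = r / 2 * ((p - i)%:R * (p - i.+1)%:R) ^+ 2.
Proof. by move=> ip; rewrite /poly_tail -(subnSK ip) -natr1; ring. Qed.

(** With z = (p - k)(p - k - 1) the tail sum at k + 1 is of order z^2 and the gap
is of order 3 z + 1, so both conditions compare polynomials in z; the first also
uses z <= p^2. *)
Lemma admissible_poly_tail p mu1 mu2 lam : 0 < lam -> 0 < mu2 ->
  4 * lam * p%:R ^+ 2 <= mu1 ->
  admissible p mu1 mu2 lam (poly_tail p (lam / mu2)).
Proof.
move=> lam0 mu20 h1; set r := lam / mu2.
have r0 : 0 < r by rewrite divr_gt0.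
have rE : mu2 * r = lam by rewrite /r; field; rewrite lt0r_neq0.
clearbody r.
have xy0 i : 0 <= (p - i)%:R * (p - i.+1)%:R :> R by rewrite mulr_ge0.
split=> k.
- by rewrite mulr_ge0 ?sqr_ge0 // divr_ge0 // ltW.
- by move=> pk; rewrite /poly_tail (eqP pk) mul0r expr0n /= mulr0.
- move=> kp; rewrite gap_poly_tail //.
  by apply: mulr_gt0; [lra|have := xy0 k; lra].
- move=> kp; rewrite gap_poly_tail // poly_tailS //.
  have le : (p - k)%:R * (p - k.+1)%:R <= p%:R ^+ 2 :> R.
    by rewrite expr2 ler_pM // ler_nat leq_subr.
  move: (xy0 k) le; set z := _ * _; move=> z0 le.
  have : 4 * lam * z * z <= mu1 * z.
    rewrite ler_wpM2r //; apply: le_trans h1.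
    by rewrite ler_wpM2l // mulr_ge0 // ltW.
  have : 0 <= mu1 by apply: le_trans h1; rewrite !mulr_ge0 ?sqr_ge0 // ltW.
  move=> mu10 h; rewrite (_ : _ * (r / 2 * _) = 4 * r * (4 * lam * z * z)); last by field.
  rewrite (_ : mu1 * _ = 4 * r * (3/2 * (mu1 * z) + mu1 / 2)); last by field.
  rewrite ler_wpM2l ?mulr_ge0 ?(ltW r0) //.
  have : 0 <= mu1 * z by rewrite mulr_ge0.
  lra.
- move=> kp; rewrite gap_poly_tail // poly_tailS //.
  move: (xy0 k); set z := _ * _; clearbody z => z0.
  rewrite (_ : mu2 * _ = 4 * (mu2 * r) * r * (3 * z + 1) ^+ 2); last by ring.
  rewrite rE (_ : 64 * lam * _ = 4 * lam * r * (8 * z ^+ 2)); last by field.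
  rewrite ler_wpM2l; first by [].
    by rewrite !mulr_ge0 // ltW.
  nra.
Qed.

Lemma sum_coord_poly_tail p r :
  \sum_(i < p) coord (poly_tail p r) i ^+ 2 <= 4 * r ^+ 2 * p%:R ^+ 7.
Proof.
have -> : 4 * r ^+ 2 * p%:R ^+ 7 = \sum_(i < p) 4 * r ^+ 2 * p%:R ^+ 6.
  by rewrite sumr_const card_ord -[RHS]mulr_natr; ring.
apply: ler_sum => i _.
rewrite coord_poly_tail (_ : (2 * r * _) ^+ 2 = 4 * r ^+ 2 * (p - i)%:R ^+ 6); last first.
  by ring.
have r2 : 0 <= 4 * r ^+ 2 by rewrite mulr_ge0 // sqr_ge0.
by rewrite ler_wpM2l // ler_pXn2r ?nnegrE // ler_nat leq_subr.
Qed.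

Lemma coord_poly_tail_ge p r i : 0 <= r -> (i < p)%N ->
  4 * r ^+ 2 <= coord (poly_tail p r) i ^+ 2.
Proof.
move=> r0 ip.
rewrite coord_poly_tail (_ : (2 * r * _) ^+ 2 = 4 * r ^+ 2 * (p - i)%:R ^+ 6); last first.
  by ring.
have r2 : 0 <= 4 * r ^+ 2 by rewrite mulr_ge0 // sqr_ge0.
by rewrite ler_peMr // exprn_ege1 // ler1n subn_gt0.
Qed.

End Polynomial.

(** * Minimizers with doubly exponentially decreasing coordinates *)

Section DoubleExponential.
Context {R : realType}.

(** The orbit of 1 under x |-> x^2 / 512.  The constant 512 leaves room for the
factor 64 of [admissible] once each gap is bounded below by half of the tail
sum. *)
Definition dexp i : R := 512 / 512 ^+ (2 ^ i).

Definition dexp_tail (n : nat) (r : R) i : R := if (i < n)%N then r * dexp i else 0.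

Lemma pow512_gt0 m : 0 < 512 ^+ m :> R.
Proof. by apply: exprn_gt0; rewrite ltr0n. Qed.

Lemma dexp_gt0 i : 0 < dexp i.
Proof. by apply: divr_gt0; [rewrite ltr0n|exact: pow512_gt0]. Qed.

Lemma dexpS i : dexp i.+1 = dexp i ^+ 2 / 512.
Proof.
rewrite /dexp expnSr exprM; field.
exact/lt0r_neq0/pow512_gt0.
Qed.

Lemma dexp0 : dexp 0 = 1.
Proof. by rewrite /dexp expn0 expr1 divff ?pnatr_eq0. Qed.

Lemma dexp_le1 i : dexp i <= 1.
Proof.
elim: i => [|i IH]; first by rewrite dexp0.
rewrite dexpS; have := dexp_gt0 i; nra.
Qed.

Lemma dexpS_le i : dexp i.+1 <= dexp i / 512.
Proof. rewrite dexpS; have := dexp_le1 i; have := dexp_gt0 i; nra. Qed.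

Lemma dexp_antitone i j : (i <= j)%N -> dexp j <= dexp i.
Proof.
move=> /subnK <-; elim: (j - i)%N => [//|m IH].
apply: le_trans IH; rewrite addSn; have := dexpS_le (m + i).
have := dexp_gt0 (m + i); lra.
Qed.

Section Tail.
Variables (n : nat) (r : R).
Hypothesis r0 : 0 < r.
Let s := dexp_tail n r.

Lemma dexp_tail_ge0 i : 0 <= s i.
Proof. by rewrite /s /dexp_tail; case: ifP => // _; rewrite mulr_ge0 ?ltW ?dexp_gt0. Qed.

Lemma dexp_tail_le i : s i <= r * dexp i.
Proof.
rewrite /s /dexp_tail; case: ifP => // _; by rewrite mulr_ge0 ?ltW ?dexp_gt0.
Qed.

Lemma dexp_tail_lt i : (i < n)%N -> s i = r * dexp i.
Proof. by rewrite /s /dexp_tail => ->. Qed.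

Lemma gap_dexp_tail_ge i : (i < n)%N -> r * dexp i / 2 <= gap s i.
Proof.
move=> ni; rewrite /gap /coord (dexp_tail_lt i) //.
have := dexp_tail_ge0 i.+2; have := dexp_tail_le i.+1.
have := ler_wpM2l (ltW r0) (dexpS_le i).
have : 0 < r * dexp i by rewrite mulr_gt0 ?dexp_gt0.
lra.
Qed.

Lemma coord_dexp_tail_bound i : (i < n)%N -> r * dexp i / 2 <= coord s i <= r.
Proof.
move=> ni; rewrite /coord (dexp_tail_lt i) //.
have := dexp_tail_ge0 i.+1; have := dexp_tail_le i.+1.
have := ler_wpM2l (ltW r0) (dexpS_le i).
have := ler_wpM2l (ltW r0) (dexp_le1 i).
have : 0 < r * dexp i by rewrite mulr_gt0 ?dexp_gt0.
move=> ? ? ? ? ?; apply/andP; split; lra.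
Qed.

(** Each coordinate is at most r, and the coordinates sum to the initial tail
sum r. *)
Lemma sum_coord_dexp_tail : (0 < n)%N -> \sum_(i < n) coord s i ^+ 2 <= r ^+ 2.
Proof.
move=> n0.
have le : \sum_(i < n) coord s i ^+ 2 <= \sum_(i < n) r * coord s i.
  apply: ler_sum => i _; have /andP[h1 h2] := coord_dexp_tail_bound _ (ltn_ord i).
  rewrite expr2 ler_wpM2r //; apply: le_trans h1.
  have q0 : 0 < r * dexp i by rewrite mulr_gt0 ?dexp_gt0.
  lra.
apply: (le_trans le); rewrite -mulr_sumr.
have -> : \sum_(i < n) coord s i = s 0 - s n.
  rewrite -(big_mkord xpredT (coord s)) -[RHS]opprB -telescope_sumr // -sumrN.
  by apply: eq_bigr => i _; rewrite opprB.
have -> : s n = 0 by rewrite /s /dexp_tail ltnn.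
by rewrite dexp_tail_lt // dexp0 mulr1 subr0.
Qed.

End Tail.

Lemma admissible_dexp_tail n mu1 mu2 lam : 0 < lam -> 0 < mu2 -> lam <= mu1 ->
  admissible n mu1 mu2 lam (dexp_tail n (lam / mu2)).
Proof.
move=> lam0 mu20 h1; set r := lam / mu2.
have r0 : 0 < r by rewrite divr_gt0.
have rE : mu2 * r = lam by rewrite /r; field; rewrite lt0r_neq0.
clearbody r.
split=> k.
- exact: dexp_tail_ge0.
- by rewrite /dexp_tail leqNgt => /negbTE ->.
- move=> kn; apply: lt_le_trans (gap_dexp_tail_ge _ _ r0 _ kn).
  by rewrite divr_gt0 // mulr_gt0 ?dexp_gt0.
- move=> kn; have := gap_dexp_tail_ge _ _ r0 _ kn.
  have := dexp_tail_le n _ r0 k.+1.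
  have := ler_wpM2l (ltW r0) (dexpS_le k).
  have : 0 < r * dexp k by rewrite mulr_gt0 ?dexp_gt0.
  set q := r * dexp k => q0 a b c.
  have sk : dexp_tail n r k.+1 <= q / 512 by rewrite /q; lra.
  have : lam * dexp_tail n r k.+1 <= lam * (q / 512) by rewrite ler_wpM2l // ltW.
  have : lam * q <= mu1 * q by rewrite ler_wpM2r // ltW.
  have : mu1 * (q / 2) <= mu1 * gap (dexp_tail n r) k.
    by rewrite ler_wpM2l //; lra.
  have : 0 < lam * q by rewrite mulr_gt0.
  lra.
- move=> kn; have g := gap_dexp_tail_ge _ _ r0 _ kn.
  have := dexp_tail_le n _ r0 k.+1; rewrite dexpS => a.
  have q0 : 0 < r * dexp k by rewrite mulr_gt0 ?dexp_gt0.
  have : mu2 * (r * dexp k / 2) ^+ 2 <= mu2 * gap (dexp_tail n r) k ^+ 2.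
    have q2 : 0 <= r * dexp k / 2 by lra.
    have g0 := le_trans q2 g.
    by rewrite ler_wpM2l ?(ltW mu20) // ler_pXn2r ?nnegrE.
  rewrite (_ : mu2 * _ = (mu2 * r) * r * dexp k ^+ 2 / 4); last by field.
  rewrite rE => h.
  have : lam * dexp_tail n r k.+1 <= lam * (r * (dexp k ^+ 2 / 512)).
    by rewrite ler_wpM2l // ltW.
  have : 0 < lam * r * dexp k ^+ 2.
    by apply: mulr_gt0; [exact: mulr_gt0|exact/exprn_gt0/dexp_gt0].
  lra.
Qed.

End DoubleExponential.

(** * Choice of the parameters *)

Section Tuning.
Context {R : realType}.

Lemma powR_2_7 (K : R) : 0 <= K -> (K `^ (2 / 7)) ^+ 7 = K ^+ 2.
Proof.
move=> K0; rewrite -powR_mulrn ?powR_ge0 // -powRrM (_ : 2 / 7 * 7 = 2) ?powR_mulrn //.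
by field.
Qed.

Lemma powR_2_7_ge2 (K : R) : 16 <= K -> 2 <= K `^ (2 / 7).
Proof.
move=> K16; have K0 : 0 <= K by lra.
rewrite -(@ler_pXn2r _ 7) ?nnegrE ?powR_ge0 // powR_2_7 //.
apply: (@le_trans _ _ (16 ^+ 2)); first by lra.
by rewrite ler_pXn2r ?nnegrE.
Qed.

(** Since 512 <= 18^3, the logarithm of z in base 18 is less than 3 * 2^N, hence
at most 4^N because N >= 2; then ln 4 <= 2. *)
Lemma lnln_le (z : R) (N : nat) : (1 < N)%N -> 1 < z -> z < 512 ^+ (2 ^ N) ->
  ln (log_base 18 z) <= 2 * N%:R.
Proof.
move=> N1 z1 zN; have ln18 : 0 < ln (18 : R) by rewrite ln_gt0 // ltr1n.
have z0 : 0 < z by lra.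
have Y0 : 0 < log_base 18 z by rewrite divr_gt0 // ln_gt0.
have h512 : 0 < 512 :> R by rewrite ltr0n.
have ln512 : ln (512 : R) <= 3 * ln 18.
  have h18 : 0 < 18 :> R by rewrite ltr0n.
  have h18' : 0 < 18 ^+ 3 :> R by apply: exprn_gt0.
  by rewrite mulr_natl -lnXn // ler_ln ?posrE //; lra.
have lnz : ln z <= ln 512 * (2 ^ N)%:R.
  have hp : 0 < 512 ^+ (2 ^ N) :> R by apply: exprn_gt0.
  by rewrite mulr_natr -lnXn // ler_ln ?posrE // ltW.
have pow4 : 3 * (2 ^ N)%:R <= 4 ^+ N :> R.
  rewrite -natrM -natrX ler_nat (_ : 4 = 2 * 2)%N // expnMn leq_mul2r.
  by rewrite (leq_trans (_ : 3 <= 2 ^ 2)%N) ?orbT // leq_exp2l.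
have le4 : log_base 18 z <= 4 ^+ N.
  apply: le_trans pow4; rewrite ler_pdivrMr //.
  have : 0 <= (2 ^ N)%:R :> R by [].
  nra.
have ln4 : ln (4 : R) <= 2.
  rewrite (_ : 4 = 2 ^+ 2); last by ring.
  have := @le_ln1Dx R 1; rewrite lnXn // => h.
  have : ln (1 + 1 : R) <= 1 by apply: h; lra.
  rewrite mulr2n (_ : 1 + 1 = 2) //; lra.
apply: (@le_trans _ _ (ln (4 ^+ N))).
  by rewrite ler_ln ?posrE // exprn_gt0.
by rewrite lnXn // mulr_natr lerMn2r ln4 orbT.
Qed.

(** The assumption 512^2 <= z makes the bracket start at n = 1: a chain must have
at least one vector. *)
Lemma exists_dexp_bracket (z : R) : 512 ^+ 2 <= z ->
  exists n : nat, [/\ (0 < n)%N, 512 ^+ (2 ^ n) <= z & z < 512 ^+ (2 ^ n.+1)].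
Proof.
move=> z2.
have ex : exists N : nat, z < 512 ^+ (2 ^ N).
  exists (Num.truncn z).+1; apply: lt_le_trans (truncnS_gt z) _.
  rewrite -natrX ler_nat; apply: ltnW.
  apply: ltn_trans (ltn_expl _ (isT : 1 < 2)%N) _; exact: ltn_expl.
case: (ex_minnP ex) => -[|[|n]] zN min.
- by move: zN; rewrite expn0 expr1; lra.
- by move: zN; rewrite expn1; lra.
exists n.+1; split => //; rewrite leNgt; apply/negP => lt.
by have := min _ lt; rewrite ltnn.
Qed.

End Tuning.

Theorem theorem1 (R : realType) :
  exists c c1 c2 c3 : R,
    [/\ 0 < c, 0 < c1, 0 < c2 & 0 < c3] /\
    forall mu1 mu2 lambda D eps : R,
      0 < mu1 -> 0 < mu2 -> 0 < lambda -> 0 < D -> 0 < eps ->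
      c1 <= mu1 / lambda ->
      c2 <= mu2 / lambda * D ->
      eps < c3 * lambda ^+ 3 / mu2 ^+ 2 ->
      forall A : algorithm R,
      exists (d : nat) (f : 'rV[R]_d -> R) (wstar : 'rV[R]_d),
        [/\ (0 < d)%N,
            [/\ twice_differentiable f,
                strongly_convex lambda f,
                lipschitz_gradient mu1 f &
                lipschitz_hessian mu2 f],
            (forall w : 'rV[R]_d, f wstar <= f w),
            enorm (iterate A f 1 - wstar) <= D &
            forall T : nat, (1 <= T)%N ->
              f (iterate A f T) - f wstar <= eps ->
              c * (Num.min (Num.sqrt (mu1 / lambda))
                           ((mu2 / lambda * D) `^ (2 / 7)) +
                   ln (log_base 18 (lambda ^+ 3 / mu2 ^+ 2 / eps)))
                <= T%:R].
Proof.
exists (1 / 4), 4, 16, (512 ^- 2); split.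
  by split; [lra|lra|lra|rewrite invr_gt0; exact: pow512_gt0].
move=> mu1 mu2 lam D eps mu10 mu20 lam0 D0 eps0 hM hK heps A.
set X := Num.min _ _; set Y := ln _; set K := mu2 / lam * D in hK X *.
pose r := lam / mu2; pose S := lam ^+ 3 / mu2 ^+ 2.
have rn0 : r != 0 by rewrite mulf_neq0 ?invr_eq0 ?lt0r_neq0.
have r0 : 0 < r by rewrite divr_gt0.
have SE : S = lam * r ^+ 2 by rewrite /S /r; field; rewrite lt0r_neq0.
have KE : K = D / r by rewrite /K /r; field; rewrite !lt0r_neq0.
have lam_mu1 : 4 * lam <= mu1 by move: hM; rewrite ler_pdivlMr.
have S0 : 0 < S by rewrite divr_gt0 ?exprn_gt0.
have Seps : 512 ^+ 2 < S / eps.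
  rewrite ltr_pdivlMr // -ltr_pdivlMl ?pow512_gt0 //.
  by rewrite /S mulrA; exact: heps.
(* (X + Y) / 4 is at most half of the larger of X and Y. *)
have finish (n : nat) : X <= 2 * n.+1%:R -> Y <= 2 * n.+1%:R ->
    forall T : nat, (n < T)%N -> 1 / 4 * (X + Y) <= T%:R.
  move=> Xn Yn T nT; have : n.+1%:R <= T%:R :> R by rewrite ler_nat.
  lra.
suff [n [s [n0 adm sD se [Xn Yn]]]] : exists n s, [/\ (0 < n)%N,
    admissible n mu1 mu2 lam s, \sum_(i < n) coord s i ^+ 2 <= D ^+ 2,
    (forall i, (i < n)%N -> eps < lam / 2 * coord s i ^+ 2) &
    X <= 2 * n.+1%:R /\ Y <= 2 * n.+1%:R].
  have lam2 : 2 * lam <= mu1 by lra.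
  have [d [f [ws [h1 h2 h3 h4 h5]]]] :=
    hard_instance A n mu1 mu2 lam D eps s n0 lam0 lam2 (ltW mu20) (ltW D0) adm sD se.
  exists d, f, ws; split => // T T1 /(h5 T T1); exact: finish.
(* r = lam / mu2 is the natural unit of length, in which D is K. *)
have K2 : D ^+ 2 = r ^+ 2 * K ^+ 2 by rewrite KE; field.
case: (lerP Y X) => XY.
- have X2 : 2 <= X.
    rewrite /X le_min powR_2_7_ge2 // andbT -(@ler_pXn2r _ 2) ?nnegrE ?sqrtr_ge0 //.
    rewrite sqr_sqrtr; lra.
  have XM : lam * X ^+ 2 <= mu1.
    rewrite mulrC -ler_pdivlMr // -[leRHS]sqr_sqrtr ?divr_ge0 ?(ltW mu10) ?(ltW lam0) //.
    rewrite ler_pXn2r ?nnegrE ?sqrtr_ge0 //; last by lra.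
    by rewrite ge_min lexx.
  have XK : X ^+ 7 <= K ^+ 2.
    rewrite -powR_2_7; last by lra.
    rewrite ler_pXn2r ?nnegrE ?powR_ge0 //; last by lra.
    by rewrite ge_min lexx orbT.
  (* Half of X, so that lam p^2 <= mu1 / 4 and p^7 <= K^2 / 2^7. *)
  pose p := Num.truncn (X / 2); exists p, (poly_tail p r).
  have X20 : 0 <= X / 2 by lra.
  have /andP[p1 p2] := truncn_itv X20; rewrite -/p in p1 p2.
  have pX : X <= 2 * p.+1%:R by lra.
  have p0 : (0 < p)%N by rewrite truncn_gt0; lra.
  split => //; last by split => //; lra.
  + apply: admissible_poly_tail => //.
    have : p%:R ^+ 2 <= (X / 2) ^+ 2 by rewrite ler_pXn2r ?nnegrE.
    move=> /(ler_wpM2l (ltW lam0)); rewrite exprMn; lra.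
  + apply: (le_trans (sum_coord_poly_tail _ _)).
    have : p%:R ^+ 7 <= (X / 2) ^+ 7 by rewrite ler_pXn2r ?nnegrE.
    rewrite exprMn => p7; rewrite K2 -mulrA mulrCA ler_wpM2l ?sqr_ge0 //.
    have := sqr_ge0 K; lra.
  + move=> i ip; have := coord_poly_tail_ge _ _ _ (ltW r0) ip.
    move=> /(ler_wpM2l (ltW lam0)).
    have : eps < S.
      move: Seps; rewrite ltr_pdivlMr //; nra.
    rewrite SE; lra.
- have [n [n0 nz zn]] := exists_dexp_bracket _ (ltW Seps).
  have Yn : Y <= 2 * n.+1%:R.
    by apply: (lnln_le _ _ _ _ zn) => //; lra.
  exists n, (dexp_tail n r); split=> //; last by split => //; lra.
  + by apply: admissible_dexp_tail => //; lra.
  + apply: (le_trans (sum_coord_dexp_tail _ _ r0 n0)).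
    rewrite K2 ler_peMr ?sqr_ge0 // exprn_ege1 //; lra.
  + move=> i ni; have /andP[h _] := coord_dexp_tail_bound _ _ r0 _ ni.
    have hi : dexp n.-1 <= dexp i :> R by apply: dexp_antitone; rewrite -ltnS prednK.
    have e : dexp n.-1 ^+ 2 = 512 ^+ 2 / 512 ^+ (2 ^ n) :> R.
      by rewrite -{2}(prednK n0) /dexp expnSr exprM; field; exact/lt0r_neq0/pow512_gt0.
    have : (r / 2) ^+ 2 * dexp n.-1 ^+ 2 <= coord (dexp_tail n r) i ^+ 2.
      have le : r / 2 * dexp n.-1 <= coord (dexp_tail n r) i.
        by apply: le_trans h; rewrite mulrAC ler_pM2r ?invr_gt0 // ler_pM2l.
      have d0 : 0 <= r / 2 * dexp n.-1.
        by apply/ltW/mulr_gt0; [lra|exact: dexp_gt0].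
      by rewrite -exprMn ler_pXn2r ?nnegrE // (le_trans d0).
    move=> /(ler_wpM2l (ltW lam0)); rewrite e.
    move: nz; rewrite ler_pdivlMr // => nz.
    have : eps <= S / 512 ^+ (2 ^ n) by rewrite ler_pdivlMr ?pow512_gt0 // mulrC.
    rewrite SE; set q := (_ ^- _) => a b.
    nra.
Qed.
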